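(* Let $f:[0,1]\to\mathbb{R}$ be continuous. Then for every $y\in[0,1]$, $$[\![f]\!](y)=\int_0^y f(\xi)\,d\xi+\left(\frac12-y\right)\int_0^1 f(\xi)\,d\xi-\int_0^1\int_0^\tau f(\xi)\,d\xi\,d\tau$$ and $$[\![f]\!](y)=\int_0^y f(\xi)\,d\xi-\int_0^1\left(\frac12+y-\xi\right)f(\xi)\,d\xi .$$
   Context: For a continuous function $f:[0,1]\to\mathbb{R}$ define its average $\langle f\rangle:=\int_0^1 f(y)\,dy$, its fluctuating part $\{f\}(y):=f(y)-\langle f\rangle$, and the function $$[\![f]\!](y):=\int_0^y\{f\}(\xi)\,d\xi-\int_0^1\int_0^\tau\{f\}(\xi)\,d\xi\,d\tau .$$ *)

(* Defs.v *)
From Stdlib Require Import Reals.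
From Coquelicot Require Import Coquelicot.
Open Scope R_scope.

(* A function on [0,1] is represented by a total [f : R -> R]; every definition
   below reads [f] only on [0,1] when [y] lies in [0,1]. *)

(* The relative topology of [0,1] is used, so continuity at the endpoints
   is one-sided and nothing is required of [f] outside [0,1]. *)
Definition continuous_on_unit (f : R -> R) : Prop :=
  continuous_on (fun x : R => 0 <= x <= 1) f.

Definition average (f : R -> R) : R := RInt f 0 1.

Definition fluct (f : R -> R) (y : R) : R := f y - average f.

Definition dbrack (f : R -> R) (y : R) : R :=
  RInt (fun xi => fluct f xi) 0 y
  - RInt (fun tau => RInt (fun xi => fluct f xi) 0 tau) 0 1.

(* Main.v *)
Require Import Defs.
From Stdlib Require Import Reals Lra.
From Coquelicot Require Import Coquelicot.
Open Scope R_scope.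

(** Clamping the argument to [0,1] extends [f] continuously to the real line
    without changing any of the integrals.  With [F y] the integral of [f] from
    [0] to [y], the integral of [fluct f] from [0] to [t] is [F t - t * F 1],
    whose mean over [0,1] is that of [F] minus [F 1 / 2]; this is the first
    formula.  The second follows from it by integrating [F] by parts. *)

Definition clamp (x : R) : R := Rmax 0 (Rmin x 1).

Lemma clamp_bounds (x : R) : 0 <= clamp x <= 1.
Proof.
unfold clamp, Rmax, Rmin.
destruct (Rle_dec x 1); destruct (Rle_dec 0 _); lra.
Qed.

Lemma clamp_id (x : R) : 0 <= x <= 1 -> clamp x = x.
Proof. intros H; unfold clamp; rewrite Rmin_left, Rmax_right; lra. Qed.

Lemma clamp_dist (x z : R) : Rabs (clamp z - clamp x) <= Rabs (z - x).
Proof.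
unfold clamp, Rmax, Rmin.
destruct (Rle_dec x 1); destruct (Rle_dec z 1);
  repeat destruct (Rle_dec 0 _); unfold Rabs;
  repeat destruct (Rcase_abs _); lra.
Qed.

(** [clamp] is 1-Lipschitz with values in [0,1], so the radius that relative continuity of [f] gives
    at [clamp x] also works at [x]. *)
Lemma continuous_clamp_comp (f : R -> R) :
  continuous_on_unit f -> forall x, continuous (fun z => f (clamp z)) x.
Proof.
intros hf x P HP.
destruct (hf (clamp x) (clamp_bounds x) P HP) as [e He].
exists e; intros z Hz.
apply He; [ | apply clamp_bounds].
exact (Rle_lt_trans _ _ _ (clamp_dist x z) Hz).
Qed.

Lemma RInt_ext_unit (f g : R -> R) (t : R) :
  (forall x, 0 <= x <= 1 -> f x = g x) -> 0 <= t <= 1 ->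
  RInt f 0 t = RInt g 0 t.
Proof.
intros H Ht; apply RInt_ext; intros x.
rewrite Rmin_left, Rmax_right by lra; intros Hx; apply H; lra.
Qed.

(** All the intervals of integration stay inside [0,1]; this allows [f] to be exchanged for its
    clamped extension. *)
Lemma dbrack_ext (f g : R -> R) (y : R) :
  (forall x, 0 <= x <= 1 -> f x = g x) -> 0 <= y <= 1 ->
  dbrack f y = dbrack g y.
Proof.
intros H Hy.
assert (Hfl : forall x, 0 <= x <= 1 -> fluct f x = fluct g x).
{ intros x Hx; unfold fluct, average.
  rewrite (H x Hx), (RInt_ext_unit f g 1 H) by lra; reflexivity. }
unfold dbrack; apply (f_equal2 Rminus).
- apply RInt_ext_unit; assumption.
- apply RInt_ext_unit; [ | lra].
  intros t Ht; apply RInt_ext_unit; assumption.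
Qed.

Section ContinuousOnLine.

Variable g : R -> R.
Hypothesis Hg : forall x, continuous g x.

(** Fundamental theorem of calculus. Continuity on the whole line makes the derivative two-sided at
    0 and 1 as well. *)
Lemma is_derive_primitive (x : R) : is_derive (fun t => RInt g 0 t) x (g x).
Proof.
apply (is_derive_RInt g (fun t => RInt g 0 t) 0 x); [ | apply Hg].
apply filter_forall; intros t; apply (@RInt_correct R_CompleteNormedModule).
apply (@ex_RInt_continuous R_CompleteNormedModule); auto.
Qed.

Lemma continuous_primitive (x : R) : continuous (fun t => RInt g 0 t) x.
Proof.
apply (@ex_derive_continuous R_AbsRing R_NormedModule).
exists (g x); apply is_derive_primitive.
Qed.

Lemma is_RInt_primitive (a b : R) :
  is_RInt (fun t => RInt g 0 t) a b (RInt (fun t => RInt g 0 t) a b).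
Proof.
apply (@RInt_correct R_CompleteNormedModule).
apply (@ex_RInt_continuous R_CompleteNormedModule).
intros; apply continuous_primitive.
Qed.

Lemma is_RInt_from_0 (t : R) : is_RInt g 0 t (RInt g 0 t).
Proof.
apply (@RInt_correct R_CompleteNormedModule).
apply (@ex_RInt_continuous R_CompleteNormedModule); auto.
Qed.

Lemma RInt_fluct (t : R) :
  RInt (fun x => fluct g x) 0 t = RInt g 0 t - t * average g.
Proof.
apply is_RInt_unique.
replace (t * average g) with (scal (t - 0) (average g))
  by (unfold scal; simpl; unfold mult; simpl; ring).
apply (is_RInt_minus g (fun _ => average g)).
- apply is_RInt_from_0.
- apply @is_RInt_const.
Qed.

Lemma RInt_RInt_fluct :
  RInt (fun t => RInt (fun x => fluct g x) 0 t) 0 1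
  = RInt (fun t => RInt g 0 t) 0 1 - average g / 2.
Proof.
rewrite (RInt_ext _ _ _ _ (fun t _ => RInt_fluct t)).
apply is_RInt_unique.
apply (is_RInt_minus (fun t => RInt g 0 t) (fun t => t * average g)).
- apply is_RInt_primitive.
(* The value is put as a difference of boundary values of the antiderivative
   [t * t * average g / 2]. *)
- replace (average g / 2)
    with (minus (1 * 1 * average g / 2) (0 * 0 * average g / 2))
    by (unfold minus, plus, opp; simpl; field).
  apply (is_RInt_derive (fun t => t * t * average g / 2)).
  + intros x _; auto_derive; [trivial | field].
  + intros x _; apply (@ex_derive_continuous R_AbsRing R_NormedModule).
    auto_derive; trivial.
Qed.

(** Integration by parts: with F the primitive of [g] from 0, x g(x) = (x F(x))' - F(x), and x F(x)
    runs from 0 to F(1). *)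
Lemma is_RInt_first_moment :
  is_RInt (fun x => x * g x) 0 1 (RInt g 0 1 - RInt (fun t => RInt g 0 t) 0 1).
Proof.
apply (is_RInt_ext
  (fun x => minus (RInt g 0 x + x * g x) (RInt g 0 x))).
{ intros x _; unfold minus, plus, opp; simpl; ring. }
apply (is_RInt_minus (fun x => RInt g 0 x + x * g x)); [ | apply is_RInt_primitive].
replace (RInt g 0 1) with (minus (1 * RInt g 0 1) (0 * RInt g 0 0))
  by (unfold minus, plus, opp; simpl; ring).
apply (is_RInt_derive (fun x => x * RInt g 0 x)).
- intros x _.
  replace (RInt g 0 x + x * g x) with (1 * RInt g 0 x + x * g x) by ring.
  apply (is_derive_mult (fun t => t) (fun t => RInt g 0 t)).
  + apply @is_derive_id.
  + apply is_derive_primitive.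
  + intros; apply Rmult_comm.
- intros x _; apply (continuous_plus (fun t => RInt g 0 t)).
  + apply continuous_primitive.
  + apply (continuous_mult (fun t => t) g); [apply continuous_id | apply Hg].
Qed.

(** The kernel splits into the constant [1 / 2 + y], which contributes a multiple of the integral of
    [g], and [- x], which contributes minus the first moment. *)
Lemma RInt_kernel (y : R) :
  RInt (fun x => (1 / 2 + y - x) * g x) 0 1
  = (y - 1 / 2) * RInt g 0 1 + RInt (fun t => RInt g 0 t) 0 1.
Proof.
apply is_RInt_unique.
replace ((y - 1 / 2) * RInt g 0 1 + RInt (fun t => RInt g 0 t) 0 1)
  with (minus (scal (1 / 2 + y) (RInt g 0 1))
          (RInt g 0 1 - RInt (fun t => RInt g 0 t) 0 1))
  by (unfold minus, plus, opp, scal; simpl; unfold mult; simpl; field).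
apply (is_RInt_ext
  (fun x => minus (scal (1 / 2 + y) (g x)) (x * g x))).
{ intros x _; unfold minus, plus, opp, scal; simpl; unfold mult; simpl; ring. }
apply (is_RInt_minus (fun x => scal (1 / 2 + y) (g x))).
- apply (is_RInt_scal g), is_RInt_from_0.
- apply is_RInt_first_moment.
Qed.

Lemma dbrack_eq (y : R) :
  dbrack g y = RInt g 0 y + (1 / 2 - y) * RInt g 0 1
               - RInt (fun t => RInt g 0 t) 0 1.
Proof.
unfold dbrack; rewrite RInt_fluct, RInt_RInt_fluct; unfold average; field.
Qed.

End ContinuousOnLine.

Theorem proposition1 (f : R -> R) (hf : continuous_on_unit f)
    (y : R) (hy : 0 <= y <= 1) :
  dbrack f y =
    RInt (fun xi => f xi) 0 y
    + (1 / 2 - y) * RInt (fun xi => f xi) 0 1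
    - RInt (fun tau => RInt (fun xi => f xi) 0 tau) 0 1
  /\
  dbrack f y =
    RInt (fun xi => f xi) 0 y
    - RInt (fun xi => (1 / 2 + y - xi) * f xi) 0 1.
Proof.
(* Every integral in the goal is moved from [f] to [g], which equals [f] on [0,1] and is continuous
   everywhere. *)
set (g := fun x => f (clamp x)).
assert (Hg : forall x, continuous g x) by exact (continuous_clamp_comp f hf).
assert (Hfg : forall x, 0 <= x <= 1 -> f x = g x)
  by (intros x Hx; unfold g; now rewrite clamp_id).
assert (HI : forall t, 0 <= t <= 1 -> RInt f 0 t = RInt g 0 t)
  by (intros t Ht; apply RInt_ext_unit; assumption).
rewrite (dbrack_ext f g y Hfg hy), (dbrack_eq g Hg y).
change (fun xi : R => f xi) with f.
rewrite (HI y hy), (HI 1) by lra.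
rewrite (RInt_ext_unit (fun tau => RInt f 0 tau) (fun tau => RInt g 0 tau) 1 HI)
  by lra.
rewrite (RInt_ext_unit (fun x => (1 / 2 + y - x) * f x)
           (fun x => (1 / 2 + y - x) * g x) 1)
  by (lra || (intros x Hx; now rewrite Hfg)).
rewrite (RInt_kernel g Hg y).
(* Both right-hand sides are now combinations of the same three integrals: of [g] over [0,y], of [g]
   over [0,1], and of the primitive over [0,1]. *)
split; ring.
Qed.
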